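(* Let $m\ge3$. For every decoration $\delta$ of $G_2(m)$ and every integer $0\le p\le m-3$, $$\sum_{i=0}^{m-3}\binom{i}{p}|T_i^\delta|=q_\delta^{(p)}.$$ In particular, $$\sum_{k=0}^{m-3}|T_k^\delta|=\binom m3,\qquad \sum_{k=1}^{m-3}k\,|T_k^\delta|=4|\mathcal N_\delta|,\qquad \sum_{k=2}^{m-3}k(k-1)|T_k^\delta|=2q_\delta^{(2)}.$$
   Context: Let $\Omega=\{1,\dots,m\}$. The Grassmannian geometry $G_2(m)$ has points the $2$-subsets $ij$ of $\Omega$ and blocks $b_{ijk}=\{ij,ik,jk\}$, one for each $3$-subset $\{i,j,k\}\subseteq\Omega$; $\mathcal B$ is the set of blocks and $\operatorname{supp}(b_{ijk})=\{i,j,k\}$. A decoration is a map $\delta:\mathcal B\to\{\pm1\}$. For a $4$-subset $\rho=\{i,j,k,r\}$ of $\Omega$, the Pasch configuration $P_\rho=\{b_{ijk},b_{ijr},b_{ikr},b_{jkr}\}$ has sign $\kappa_\delta(P_\rho)=\delta(b_{ijk})\delta(b_{ijr})\delta(b_{ikr})\delta(b_{jkr})$. Put $\mathcal N_\delta=\{\rho\in\binom{\Omega}{4}:\kappa_\delta(P_\rho)=-1\}$ (negative Pasch configurations). For a block $b$, $d_\delta(b)=|\{\rho\in\mathcal N_\delta:\operatorname{supp}(b)\subset\rho\}|$, and $T_k^\delta=\{b\in\mathcal B:d_\delta(b)=k\}$. The overlap invariants are: $q_\delta^{(0)}=\binom m3$, $q_\delta^{(1)}=4|\mathcal N_\delta|$,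 and for $p\ge2$, $q_\delta^{(p)}$ is the number of subsets $S\subseteq\mathcal N_\delta$ with $|S|=p$ and $\bigl|\bigcap_{\rho\in S}\rho\bigr|=3$. *)

(* Defs.v *)
From mathcomp Require Import all_boot all_order all_algebra.

Set Implicit Arguments.
Unset Strict Implicit.
Unset Printing Implicit Defensive.

(* The ground set Omega = {1, ..., m} is represented by 'I_m. *)

Definition points (m : nat) : {set {set 'I_m}} :=
  [set e : {set 'I_m} | #|e| == 2].

(* For t = {i, j, k} with three elements, this is {ij, ik, jk}. *)
Definition block_of (m : nat) (t : {set 'I_m}) : {set {set 'I_m}} :=
  [set e in points m | e \subset t].

Definition blocks (m : nat) : {set {set {set 'I_m}}} :=
  [set block_of t | t : {set 'I_m} & #|t| == 3].

(* The union of the points of b, so that supp {ij, ik, jk} = {i, j, k}. *)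
Definition supp (m : nat) (b : {set {set 'I_m}}) : {set 'I_m} := cover b.

(* A map blocks m -> {1, -1} is a total function constrained on blocks m;
   its values elsewhere are never used below. *)
Definition decoration (m : nat) (delta : {set {set 'I_m}} -> int) : Prop :=
  forall b, b \in blocks m -> delta b = 1%R \/ delta b = (-1)%R.

Definition pasch (m : nat) (rho : {set 'I_m}) : {set {set {set 'I_m}}} :=
  [set block_of t | t : {set 'I_m} & (t \subset rho) && (#|t| == 3)].

Definition kappa (m : nat) (delta : {set {set 'I_m}} -> int)
    (P : {set {set {set 'I_m}}}) : int :=
  (\prod_(b in P) delta b)%R.

Definition negative (m : nat) (delta : {set {set 'I_m}} -> int) :
    {set {set 'I_m}} :=
  [set rho : {set 'I_m} |
    (#|rho| == 4) && (kappa delta (pasch rho) == (-1)%R)].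

Definition degree (m : nat) (delta : {set {set 'I_m}} -> int)
    (b : {set {set 'I_m}}) : nat :=
  #|[set rho in negative delta | supp b \subset rho]|.

Definition layer (m : nat) (delta : {set {set 'I_m}} -> int) (k : nat) :
    {set {set {set 'I_m}}} :=
  [set b in blocks m | degree delta b == k].

Definition overlap (m : nat) (delta : {set {set 'I_m}} -> int) (p : nat) : nat :=
  match p with
  | 0 => 'C(m, 3)
  | 1 => 4 * #|negative delta|
  | _ => #|[set S : {set {set 'I_m}} |
             [&& S \subset negative delta, #|S| == p
               & #|\bigcap_(rho in S) rho| == 3]]|
  end.

(* Main.v *)
Require Import Defs.
From mathcomp Require Import all_boot all_order all_algebra.

Set Implicit Arguments.
Unset Strict Implicit.
Unset Printing Implicit Defensive.

(** Double counting of pairs [(t, S)] where [t] is a 3-subset and [S] a family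
    of [p] negative 4-subsets all containing [t]. Fixing [t] first gives
    [\sum_b 'C(degree b, p)]; fixing [S] first gives
    [\sum_S 'C(#|\bigcap_(rho in S) rho|, 3)], where the intersection is
    everything for [p = 0], has four elements for [p = 1], and at most three
    for [p >= 2] because distinct 4-subsets meet in fewer than four points. *)

(** A second element [y] of [t] puts each [x] of [t] on the point [{x, y}] of the block; a singleton
    would give an empty block. *)
Lemma supp_block_of (m : nat) (t : {set 'I_m}) : 1 < #|t| -> supp (block_of t) = t.
Proof.
move=> t_gt1; apply/setP=> x; apply/bigcupP/idP => [[e]|xt].
  by rewrite !inE => /andP[_ /subsetP]; apply.
have /card_gt0P[y] : 0 < #|t :\ x| by rewrite (cardsD1 x) xt in t_gt1.
rewrite !inE => /andP[yx yt]; exists [set x; y]; last by rewrite set21.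
by rewrite !inE cards2 (eq_sym x) yx subUset !sub1set xt yt.
Qed.

(** [supp] is a left inverse of [block_of] on 3-subsets, so distinct 3-subsets give distinct
    blocks. *)
Lemma big_blocks (m : nat) (F : {set {set 'I_m}} -> nat) :
  \sum_(b in blocks m) F b
    = \sum_(t in [set t : {set 'I_m} | #|t| == 3]) F (block_of t).
Proof.
rewrite -(big_imset F (h := @block_of m)) => [|t u]; last first.
  rewrite !inE => /eqP t3 /eqP u3 /(congr1 (@supp m)).
  by rewrite !supp_block_of ?t3 ?u3.
by apply: eq_bigl => b; congr (_ \in _); apply: eq_imset_r => t; rewrite !inE.
Qed.

(* A 4-subset containing [t] is [x |: t] for one of the [m - 3] points [x]
   outside [t]. *)
Lemma degree_leq (m : nat) (delta : {set {set 'I_m}} -> int) b :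
  b \in blocks m -> degree delta b <= m - 3.
Proof.
case/imsetP=> t; rewrite inE => /eqP t3 ->.
have -> : m - 3 = #|~: t| by rewrite cardsCs setCK card_ord t3.
apply: leq_trans (leq_imset_card (fun x => x |: t) _).
apply/subset_leq_card/subsetP=> rho.
rewrite !inE supp_block_of ?t3 // => /andP[/andP[/eqP rho4 _] t_rho].
have /eqP/cards1P[x rhoDt] : #|rho :\: t| = 1.
  by rewrite cardsD (setIidPr t_rho) rho4 t3.
have: x \in rho :\: t by rewrite rhoDt set11.
rewrite inE => /andP[xt _]; apply/imsetP; exists x; first by rewrite inE.
by rewrite -rhoDt setUC -{1}(setIidPr t_rho) setID.
Qed.

Lemma sum_layer (m : nat) (delta : {set {set 'I_m}} -> int) (F : nat -> nat) :
  \sum_(0 <= i < (m - 3).+1) F i * #|layer delta i|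
    = \sum_(b in blocks m) F (degree delta b).
Proof.
rewrite big_mkord.
rewrite (partition_big (fun b => inord (degree delta b) : 'I_(m - 3).+1) xpredT) //=.
apply: eq_bigr => i _; rewrite mulnC -sum_nat_const.
have layerE b : (b \in layer delta i)
    = (b \in blocks m) && (inord (degree delta b) == i).
  rewrite inE; case bB: (b \in blocks m) => //=.
  (* The bound on [degree] ensures that [inord] returns the degree itself and not its default
     value. *)
  by rewrite -val_eqE /= inordK // ltnS degree_leq.
rewrite -(eq_bigl _ _ layerE); apply: eq_bigr => b.
by rewrite inE => /andP[_ /eqP->].
Qed.

Lemma sum_bin_degree (m : nat) (delta : {set {set 'I_m}} -> int) p :
  \sum_(b in blocks m) 'C(degree delta b, p)
    = \sum_(S : {set {set 'I_m}} | (S \subset negative delta) && (#|S| == p))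
        'C(#|\bigcap_(rho in S) rho|, 3).
Proof.
rewrite big_blocks.
under eq_bigr => t.
  rewrite inE => /eqP t3.
  rewrite -cards_draws -sum1_card supp_block_of ?t3 //.
  over.
under [RHS]eq_bigr => S _ do rewrite -cards_draws -sum1_card.
(* Once [S] is fixed first, the condition that each member of [S] contains [t] becomes: [t] lies in
   the intersection of [S]. *)
rewrite (exchange_big_dep
  (fun S : {set {set 'I_m}} => (S \subset negative delta) && (#|S| == p))) /=.
  apply: eq_bigr => S /andP[SN Sp]; apply: eq_bigl => t.
  rewrite !inE Sp andbT andbC; congr (_ && _).
  apply/subsetP/bigcapsP => [sub rho /sub|sub rho rhoS].
    by rewrite inE => /andP[].
  by rewrite inE (subsetP SN) ?sub.
move=> t S _; rewrite inE => /andP[/subsetP sub ->]; rewrite andbT.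
by apply/subsetP=> rho /sub; rewrite inE => /andP[].
Qed.

(** An intersection with four elements would equal every member of [S], contradicting the choice of
    two distinct members. *)
Lemma card_bigcap_negative (m : nat) (delta : {set {set 'I_m}} -> int)
    (S : {set {set 'I_m}}) :
  S \subset negative delta -> 1 < #|S| -> #|\bigcap_(rho in S) rho| <= 3.
Proof.
move=> /subsetP SN /card_gt1P[rho [sigma [rhoS sigmaS neq]]].
have card4 r : r \in S -> #|r| = 4.
  by move/SN; rewrite inE => /andP[/eqP].
have sub_rho : \bigcap_(r in S) r \subset rho by apply: bigcap_inf.
have sub_sigma : \bigcap_(r in S) r \subset sigma by apply: bigcap_inf.
rewrite -ltnS -(card4 _ rhoS) ltnNge; apply: contra neq => le_rho.
have /eqP capE : \bigcap_(r in S) r == rho by rewrite eqEcard sub_rho.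
by rewrite eqEcard -{1}capE sub_sigma !card4.
Qed.

Lemma sum_bin_bigcap (m : nat) (delta : {set {set 'I_m}} -> int) p :
  \sum_(S : {set {set 'I_m}} | (S \subset negative delta) && (#|S| == p))
      'C(#|\bigcap_(rho in S) rho|, 3) = overlap delta p.
Proof.
case: p => [|[|p]] /=.
(* Only the empty family occurs, and its intersection is the whole ground set. *)
- rewrite (big_pred1 set0) => [|S]; last first.
    by rewrite cards_eq0 andbC /=; case: eqP => // ->; rewrite sub0set.
  by rewrite big_set0 cardsT card_ord.
- transitivity (\sum_(S in set1 @: negative delta) 'C(#|\bigcap_(rho in S) rho|, 3)).
    apply: eq_bigl => S; apply/andP/imsetP => [[SN /cards1P[r defS]]|[r rN ->]].
      by exists r; rewrite // -sub1set -defS.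
    by rewrite sub1set cards1.
  rewrite big_imset => [|r s _ _]; last exact: set1_inj.
  rewrite mulnC -sum_nat_const; apply: eq_bigr => r.
  by rewrite inE big_set1 => /andP[/eqP-> _].
- rewrite -sum1_card; under [RHS]eq_bigl => S do rewrite inE andbA.
  rewrite [RHS]big_mkcondr /=; apply: eq_bigr => S /andP[SN /eqP Sp].
  have := @card_bigcap_negative _ _ _ SN; rewrite Sp => /(_ isT).
  (* For [n <= 3], ['C(n, 3)] is the indicator of [n = 3]. *)
  by case: #|_| => [|[|[|[|]]]].
Qed.

Lemma sum_bin_layer (m : nat) (delta : {set {set 'I_m}} -> int) p :
  \sum_(0 <= i < (m - 3).+1) 'C(i, p) * #|layer delta i| = overlap delta p.
Proof. by rewrite (sum_layer _ (fun i => 'C(i, p))) sum_bin_degree sum_bin_bigcap. Qed.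

(** Lets the sums starting at 1 or 2 start at 0. If [n < k], the left sum is empty and the right one
    has only zero terms. *)
Lemma big_nat_drop0 (k n : nat) (F : nat -> nat) :
  (forall i, i < k -> F i = 0) -> \sum_(k <= i < n) F i = \sum_(0 <= i < n) F i.
Proof.
move=> F0; have sum0 l : l <= k -> \sum_(0 <= i < l) F i = 0.
  move=> lk; rewrite big_nat_cond big1 // => i /andP[/andP[_ il] _].
  exact: F0 (leq_trans il lk).
case: (leqP k n) => [kn|/ltnW nk]; last by rewrite big_geq // sum0.
by rewrite (@big_cat_nat _ _ _ k 0 n) //= sum0.
Qed.

Theorem theorem5p5 (m : nat) (hm : 3 <= m) (delta : {set {set 'I_m}} -> int)
    (hdelta : decoration delta) :
  (forall p : nat, p <= m - 3 ->
     \sum_(0 <= i < (m - 3).+1) 'C(i, p) * #|layer delta i| = overlap delta p)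
  /\ \sum_(0 <= k < (m - 3).+1) #|layer delta k| = 'C(m, 3)
  /\ \sum_(1 <= k < (m - 3).+1) k * #|layer delta k| = 4 * #|negative delta|
  /\ \sum_(2 <= k < (m - 3).+1) k * (k - 1) * #|layer delta k|
       = 2 * overlap delta 2.
Proof.
split=> [p _|]; first exact: sum_bin_layer.
split.
  rewrite -[RHS](sum_bin_layer delta 0).
  by apply: eq_bigr => i _; rewrite bin0 mul1n.
split.
  rewrite big_nat_drop0 => [|[]//]; rewrite -[RHS](sum_bin_layer delta 1).
  by apply: eq_bigr => i _; rewrite bin1.
rewrite big_nat_drop0 => [|[|[]]//].
rewrite -sum_bin_layer big_distrr /=.
apply: eq_bigr => i _; rewrite mulnA; congr (_ * _).
(* Reading the factor 2 as a factorial turns ['C(i, 2) * 2] into the falling factorial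
   [i * (i - 1)]. *)
by rewrite [RHS]mulnC -[X in _ = _ * X]/(2`!) bin_ffact !ffactnS ffactn0 muln1 subn1.
Qed.
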